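(* For every $n\ge1$, there is a bijection between the set of weighted $(n,n)$ Delannoy paths and the set of $DIII$ $(n,n)$-clans.
   Context: An $(n,n)$ Delannoy path is a lattice path from $(0,0)$ to $(n,n)$ consisting of unit north steps $N$, unit east steps $E$ and diagonal steps $D=(1,1)$, regarded as a word in $\{N,E,D\}$. A labelled step is a pair $(L,l)$ with $L\in\{N,E,D\}$ and $l$ a positive integer such that $l=1$ if $L=N$ or $L=E$. A weighted $(n,n)$ Delannoy path is a word $W=W_1\cdots W_r$ of labelled steps $W_i=(L_i,l_i)$, with $r$ even, such that: (1) $L_1\cdots L_r$ is an $(n,n)$ Delannoy path; (2) $L_i=N$ if and only if $L_{r+1-i}=E$; (3) with $k_i=\#\{j<i: l_j\ne1\}$, whenever $1\le i\le r/2$ and $L_i=D$, one has $2\le l_i\le 2n+1-2(i+k_i)$ and $W_{r+1-i}=(D,\,2n+3-2(i+k_i)-l_i)$; (4) either $L_{r/2}=E$ (so that $L_{r/2+1}=N$), or $W_{r/2}=(D,3)$ (so that $W_{r/2+1}=(D,2)$). An $(n,n)$-clan is a string $\gamma=c_1\cdots c_{2n}$ of symbols from $\mathbb N\cup\{+,-\}$ with equally many $+$'s and $-$'s, in which every natural number that appears appears exactly twice; two clans are equal if they have the same signs at the same positions and the same positions of matching number pairs. $rev(\gamma)=c_{2n}\cdots c_1$, and $\overline\gamma$ is obtained by exchanging $+$ and $-$. A $DIII$ $(n,n)$-clan is an $(n,n)$-clan such that (i) $\gamma=rev(\overline\gamma)$; (ii) if $c_i\in\mathbb N$ then $c_i\ne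 c_{2n+1-i}$; (iii) the number of $-$'s among $c_1,\dots,c_n$ plus the number of pairs $i<j\le n$ with $c_i=c_j\in\mathbb N$ is even. *)

(* Defs.v *)
From HB Require Import structures.
From mathcomp Require Import all_boot generic_quotient.

Set Implicit Arguments.
Unset Strict Implicit.
Unset Printing Implicit Defensive.

Local Open Scope quotient_scope.

Inductive step := North | East | Diag.

Definition nat_of_step (x : step) : nat :=
  match x with North => 0 | East => 1 | Diag => 2 end.

Definition step_of_nat (k : nat) : step :=
  match k with 0 => North | 1 => East | _ => Diag end.

Lemma nat_of_stepK : cancel nat_of_step step_of_nat.
Proof. by case. Qed.

HB.instance Definition _ := Countable.copy step (can_type nat_of_stepK).

Definition step_dx (x : step) : nat :=
  match x with North => 0 | East => 1 | Diag => 1 end.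

Definition step_dy (x : step) : nat :=
  match x with North => 1 | East => 0 | Diag => 1 end.

Definition delannoy (n : nat) (L : seq step) : bool :=
  (sumn (map step_dx L) == n) && (sumn (map step_dy L) == n).

Definition labelled_step (w : step * nat) : bool :=
  (0 < w.2) && ((w.1 != Diag) ==> (w.2 == 1)).

(* Positions in a word are numbered from 1. *)
Definition wstep (W : seq (step * nat)) (i : nat) : step * nat :=
  nth (North, 1) W i.-1.

Definition wdir (W : seq (step * nat)) (i : nat) : step := (wstep W i).1.

Definition wlab (W : seq (step * nat)) (i : nat) : nat := (wstep W i).2.

Definition wk (W : seq (step * nat)) (i : nat) : nat :=
  count (fun j => wlab W j != 1) (iota 1 i.-1).

(* The natural-number subtractions below are harmless: the bounds
   2 <= l_i <= 2n+1 - 2(i+k_i) fail for the truncated difference exactly when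
   they fail over the integers, and they make the last difference exact.
   The last clause does not restate L_{r/2+1} = N, resp. W_{r/2+1} = (D,2):
   these follow from the preceding clauses. *)
Definition weighted_delannoy (n : nat) (W : seq (step * nat)) : bool :=
  let r := size W in
  [&& all labelled_step W,
      ~~ odd r,
      delannoy n (map fst W),
      all (fun i => (wdir W i == North) == (wdir W (r.+1 - i) == East))
          (iota 1 r),
      all (fun i => (wdir W i == Diag) ==>
             [&& 2 <= wlab W i,
                 wlab W i <= (2 * n + 1) - 2 * (i + wk W i)
               & wstep W (r.+1 - i) ==
                   (Diag, (2 * n + 3) - 2 * (i + wk W i) - wlab W i)])
          (iota 1 r./2)
    & (wdir W r./2 == East) || (wstep W r./2 == (Diag, 3))].

Definition weighted_delannoy_path (n : nat) : Type :=
  {W : seq (step * nat) | weighted_delannoy n W}.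

(* [inl true] is +, [inl false] is -, and [inr a] is the natural number a. *)
Notation symbol := (bool + nat)%type.

Definition plus : symbol := inl true.
Definition minus : symbol := inl false.

Definition is_number (c : symbol) : bool := if c is inr _ then true else false.

Definition flip (c : symbol) : symbol := if c is inl b then inl (~~ b) else c.

Definition clan_string (n : nat) (s : seq symbol) : bool :=
  [&& size s == 2 * n,
      count_mem plus s == count_mem minus s
    & all (fun c => is_number c ==> (count_mem c s == 2)) s].

Definition clan_word (n : nat) : Type :=
  {s : (2 * n).-tuple symbol | clan_string n s}.

Definition matched m (s : m.-tuple symbol) (i j : 'I_m) : bool :=
  [&& i != j, is_number (tnth s i) & tnth s i == tnth s j].

Definition same_clan m (s t : m.-tuple symbol) : bool :=
  [forall i, forall b : bool, (tnth s i == inl b) == (tnth t i == inl b)]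
  && [forall i, forall j, matched s i j == matched t i j].

Lemma same_clanP m (s t : m.-tuple symbol) :
  reflect ((forall i (b : bool), (tnth s i == inl b) = (tnth t i == inl b))
           /\ (forall i j, matched s i j = matched t i j))
          (same_clan s t).
Proof.
apply: (iffP andP) => [[/forallP h1 /forallP h2]|[h1 h2]]; split.
- by move=> i b; have /forallP h := h1 i; exact: eqP (h b).
- by move=> i j; have /forallP h := h2 i; exact: eqP (h j).
- by apply/forallP => i; apply/forallP => b; rewrite h1.
- by apply/forallP => i; apply/forallP => j; rewrite h2.
Qed.

Lemma same_clan_refl m : reflexive (@same_clan m).
Proof. by move=> s; apply/same_clanP. Qed.

Lemma same_clan_sym m : symmetric (@same_clan m).
Proof. by move=> s t; apply/same_clanP/same_clanP => -[h1 h2]; split. Qed.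

Lemma same_clan_trans m : transitive (@same_clan m).
Proof.
move=> t s u /same_clanP[h1 h2] /same_clanP[h3 h4].
by apply/same_clanP; split=> *; rewrite ?h1 ?h2.
Qed.

Definition rev_flip m (s : m.-tuple symbol) : m.-tuple symbol := [tuple of rev (map flip s)].

(* The equality gamma = rev(bar gamma) is one of clans, not of strings.  Since [tnth] counts
   from 0, the first half of the word consists of the i with i < n, and
   [rev_ord] is i |-> 2n+1-i in the numbering from 1. *)
Definition DIII_word (n : nat) (s : (2 * n).-tuple symbol) : bool :=
  [&& same_clan s (rev_flip s),
      [forall i, is_number (tnth s i) ==> (tnth s i != tnth s (rev_ord i))]
    & ~~ odd (#|[set i : 'I_(2 * n) | (i < n) && (tnth s i == minus)]|
              + #|[set p : 'I_(2 * n) * 'I_(2 * n) |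
                    [&& p.1 < p.2, p.2 < n & matched s p.1 p.2]]|)].

Definition clan_eqv (n : nat) (x y : clan_word n) : bool :=
  same_clan (val x) (val y).

Lemma clan_eqv_refl n : reflexive (@clan_eqv n).
Proof. by move=> x; apply: same_clan_refl. Qed.

Lemma clan_eqv_sym n : symmetric (@clan_eqv n).
Proof. by move=> x y; apply: same_clan_sym. Qed.

Lemma clan_eqv_trans n : transitive (@clan_eqv n).
Proof. by move=> y x z; apply: same_clan_trans. Qed.

Canonical clan_equiv (n : nat) :=
  EquivRel (@clan_eqv n) (@clan_eqv_refl n) (@clan_eqv_sym n)
           (@clan_eqv_trans n).

Definition clan (n : nat) : Type := {eq_quot (@clan_equiv n)}.

(* Independent of the representative, by [clan_DIII_pi] below. *)
Definition clan_DIII (n : nat) (g : clan n) : bool := DIII_word (val (repr g)).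

Lemma is_numberE (c : symbol) :
  is_number c = (c != inl true) && (c != inl false).
Proof. by case: c => [[]|]. Qed.

Lemma tnth_rev_flip m (s : m.-tuple symbol) i :
  tnth (rev_flip s) i = flip (tnth s (rev_ord i)).
Proof.
rewrite (tnth_nth plus) /= nth_rev ?size_map ?size_tuple //.
by rewrite (nth_map plus) ?size_tuple ?(tnth_nth plus) // ltn_subrL /=;
   case: m s i => [s []|].
Qed.

Lemma flip_inl (c : symbol) b : (flip c == inl b) = (c == inl (~~ b)).
Proof. by case: c b => [[]|a] []. Qed.

Lemma matched_rev_flip m (s : m.-tuple symbol) i j :
  matched (rev_flip s) i j = matched s (rev_ord i) (rev_ord j).
Proof.
rewrite /matched !tnth_rev_flip (inj_eq rev_ord_inj); congr (_ && _).
by case: (tnth s _) => [b|a] //=; case: (tnth s _).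
Qed.

Lemma same_clan_rev_flip m (s t : m.-tuple symbol) :
  same_clan s t -> same_clan (rev_flip s) (rev_flip t).
Proof.
case/same_clanP=> h1 h2; apply/same_clanP; split=> i.
  by move=> b; rewrite !tnth_rev_flip !flip_inl h1.
by move=> j; rewrite !matched_rev_flip h2.
Qed.

Lemma DIII_word_same_clan n (s t : (2 * n).-tuple symbol) :
  same_clan s t -> DIII_word s = DIII_word t.
Proof.
move=> st; have /same_clanP[h1 h2] := st; have st' := same_clan_rev_flip st.
have ts : same_clan t s by rewrite same_clan_sym.
have ts' : same_clan (rev_flip t) (rev_flip s) by rewrite same_clan_sym.
rewrite /DIII_word; congr (_ && (_ && ~~ odd (_ + _))).
- apply/idP/idP => h; first exact: same_clan_trans (same_clan_trans ts h) st'.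
  exact: same_clan_trans (same_clan_trans st h) ts'.
- have rev_neq (i : 'I_(2 * n)) : i != rev_ord i.
    have lt_i := ltn_ord i; apply/eqP => /(congr1 val) /= e.
    have : i + i.+1 = 2 * n by rewrite {1}e subnK.
    by move/(congr1 odd); rewrite addnS /= addnn odd_double mul2n odd_double.
  have eq_i (i : 'I_(2 * n)) :
      (is_number (tnth s i) ==> (tnth s i != tnth s (rev_ord i)))
      = (is_number (tnth t i) ==> (tnth t i != tnth t (rev_ord i))).
    have := h2 i (rev_ord i); rewrite /matched rev_neq /= !is_numberE !h1.
    by case: (_ != inl true); case: (_ != inl false) => //= ->.
  exact: eq_forallb.
- by apply: eq_card => i; rewrite !inE h1.
- by apply: eq_card => p; rewrite !inE h2.
Qed.

Lemma clan_DIII_pi n (x : clan_word n) :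
  clan_DIII (\pi_(clan n) x) = DIII_word (val x).
Proof.
apply: DIII_word_same_clan; rewrite same_clan_sym.
have /eqmodP : x = repr (\pi_(clan n) x) %[mod {eq_quot (@clan_equiv n)}].
  by rewrite reprK.
by [].
Qed.

Definition DIII_clan (n : nat) : Type := {g : clan n | clan_DIII g}.

(* Main.v *)
(* Read a clan by mirror pairs of positions {i, 2n+1-i}.  By (i) and (ii) the
   symbol at i <= n is a sign or is matched into another pair, so a clan
   satisfying (i) and (ii) amounts to an involution of {1, ..., n} with a colour
   on each orbit: the sign for a fixed point, and for a 2-cycle whether the two
   matched positions lie in the same half.  Condition (iii) says that evenly many
   orbits have the colour counted there.  Removing the orbit of the first
   remaining element, one has with m elements left 2 choices for a fixed point
   and 2(m-1) choices for a 2-cycle, exactly as for the i-th step of a Delannoy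
   path (N or E, or D with one of its admissible labels).  The colour of the last
   orbit is forced by (iii), the corresponding bit of the middle step by (4); both
   sets are therefore in bijection with the codes deprived of their last bit. *)
Require Import Defs.
From mathcomp Require Import all_boot generic_quotient zify.

Set Implicit Arguments.
Unset Strict Implicit.
Unset Printing Implicit Defensive.

(** * Codes *)

(** Preimages are chosen on either side, so no inverse has to be written down; both sets are later
    compared through their codes without the last bit. *)
Lemma bijection_of_same_image (A B : choiceType) (C : eqType)
    (f : A -> C) (g : B -> C) :
  injective f -> injective g ->
  (forall c, (exists a, f a = c) <-> (exists b, g b = c)) ->
  exists h : A -> B, bijective h.
Proof.
move=> f_inj g_inj fg.
have gf a : exists b, g b == f a.
  by have /fg[b gb] : exists a', f a' = f a by [exists a]; exists b; apply/eqP.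
have fg' b : exists a, f a == g b.
  by have /fg[a fa] : exists b', g b' = g b by [exists b]; exists a; apply/eqP.
exists (fun a => xchoose (gf a)), (fun b => xchoose (fg' b)) => [a|b].
  apply: f_inj; rewrite (eqP (xchooseP (fg' _))).
  exact: (eqP (xchooseP (gf _))).
apply: g_inj; rewrite (eqP (xchooseP (gf _))).
exact: (eqP (xchooseP (fg' _))).
Qed.

(* With m mirror pairs left, the code l < 2m describes the next step: N, E, or D
   with label l.  On the clan side l = 0, 1 is a sign and l = 2(q+1) + b matches
   the first pair with the q-th of the others, b being the colour.  A step thus
   uses up one or two pairs. *)
Definition width (l : nat) : nat := if l < 2 then 1 else 2.

Fixpoint valid (m : nat) (c : seq nat) : bool :=
  if c is l :: c' then (l < m.*2) && valid (m - width l) c' else m == 0.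

(** The last entry of a valid code lies below 4, and halving it forgets one bit: N against E or
    label 2 against 3 on paths, the colour of the last orbit on clans. *)
Definition base (c : seq nat) : seq nat * nat :=
  (take (size c).-1 c, (last 0 c)./2).

Lemma base_rcons (c : seq nat) (l : nat) : base (rcons c l) = (c, l./2).
Proof. by rewrite /base size_rcons last_rcons -cats1 take_size_cat. Qed.

Lemma valid_nonempty (m : nat) (c : seq nat) :
  0 < m -> valid m c -> exists c' l, c = rcons c' l.
Proof.
move=> m_gt0; case/lastP: c => [|c l _]; last by exists c, l.
by case: m m_gt0.
Qed.

(** The thresholds that [valid] and [width] apply to an entry, 2 and [m.*2], are even, so they do
    not see its last bit. *)
Lemma valid_rcons_half (m : nat) (c : seq nat) (l l' : nat) :
  l./2 = l'./2 -> valid m (rcons c l) = valid m (rcons c l').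
Proof.
move=> ll'; elim: c m => [|x c IHc] m /=; last by rewrite IHc.
by rewrite /width -!(@ltn_half_double _ 1) -!ltn_half_double ll'.
Qed.

Lemma valid_last_lt4 (m : nat) (c : seq nat) (l : nat) :
  valid m (rcons c l) -> l < 4.
Proof.
elim: c m => [|x c IHc] m /= /andP[]; last by move=> _; apply: IHc.
by rewrite /width; case: ifP; lia.
Qed.

(** * Coloured involutions of a list and their codes *)

Definition coloured_involution (T : eqType) (r : seq T) (sg : T -> T)
    (e : T -> bool) : Prop :=
  forall x, x \in r -> [/\ sg x \in r, sg (sg x) = x & e (sg x) = e x].

(** [k] is fuel, at least the length of [r]. In a list without repetitions [rem (sg x) r'] removes
    nothing when [x] is fixed, so both kinds of orbit share one recursion. *)
Fixpoint enc (T : eqType) (sg : T -> T) (e : T -> bool) (k : nat) (r : seq T) :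
    seq nat :=
  match k, r with
  | k'.+1, x :: r' =>
      (if sg x == x then nat_of_bool (e x)
       else (index (sg x) r').+1.*2 + e x) :: enc sg e k' (rem (sg x) r')
  | _, _ => [::]
  end.

Lemma eq_in_enc (T : eqType) (sg sg' : T -> T) (e e' : T -> bool) k (r : seq T) :
  {in r, sg =1 sg'} -> {in r, e =1 e'} -> enc sg e k r = enc sg' e' k r.
Proof.
elim: k r => [|k IHk] [|x r] //= eqs eqe.
rewrite eqs ?eqe ?mem_head //; congr (_ :: _); apply: IHk => y /mem_rem yr.
  by apply: eqs; rewrite inE yr orbT.
by apply: eqe; rewrite inE yr orbT.
Qed.

Lemma coloured_involution_behead (T : eqType) x (r : seq T) sg e :
  uniq (x :: r) -> coloured_involution (x :: r) sg e ->
  coloured_involution (rem (sg x) r) sg e.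
Proof.
move=> /= /andP[xr ur] h y; rewrite mem_rem_uniq // inE => /andP[yx yr].
have [|sy ssy ey] := h y; first by rewrite inE yr orbT.
have [sx ssx ex] := h x (mem_head _ _); split=> //.
rewrite mem_rem_uniq // inE; move: sy; rewrite inE => /orP[/eqP sy|->].
  by case/eqP: yx; rewrite -sy.
rewrite andbT; apply/eqP => sxy; move: xr.
by rewrite -ssx -sxy ssy yr.
Qed.

Lemma partner_in_behead (T : eqType) x (r : seq T) sg e :
  coloured_involution (x :: r) sg e -> sg x != x -> sg x \in r.
Proof. by move=> h /negPf sxx; have [] := h x (mem_head _ _); rewrite inE sxx. Qed.

Lemma enc_valid (T : eqType) (sg : T -> T) e k (r : seq T) :
  uniq r -> size r <= k -> coloured_involution r sg e ->
  valid (size r) (enc sg e k r).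
Proof.
elim: k r => [|k IHk] [|x r] // ur rk h /=.
have h' := coloured_involution_behead ur h.
have /andP[xr ur'] := ur; rewrite /= ltnS in rk.
have {IHk} := IHk _ (rem_uniq (sg x) ur') _ h'.
case: eqP => [sxx|/eqP sxx].
  rewrite sxx rem_id // => /(_ rk).
  have -> : width (e x) = 1 by case: (e x).
  by rewrite subn1 /= => ->; case: (e x).
have sr := partner_in_behead h sxx.
have := sr; rewrite -index_mem => i_lt.
rewrite size_rem // => IH.
have -> : width ((index (sg x) r).+1.*2 + e x) = 2.
  by [].
rewrite subn2 IH; last by lia.
by case: (e x); lia.
Qed.

(** The head code gives the partner and colour of the first element: codes of fixed points are below
    2, the others are at least 2 and split into index and colour. Induction treats the rest, and the
    partner of the head is settled by involutivity. *)
Lemma enc_inj (T : eqType) (sg sg' : T -> T) e e' k (r : seq T) :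
  uniq r -> size r <= k ->
  coloured_involution r sg e -> coloured_involution r sg' e' ->
  enc sg e k r = enc sg' e' k r -> {in r, sg =1 sg'} /\ {in r, e =1 e'}.
Proof.
elim: k r => [|k IHk] [|x r] // ur rk h h' /= [hd tl].
have [sxx' exx'] : sg x = sg' x /\ e x = e' x.
  case: eqP hd => [sx|/eqP sx]; case: eqP => [sx'|/eqP sx'].
  - by rewrite sx sx'; case: (e x); case: (e' x).
  - by case: (e x); case: (e' x); lia.
  - by case: (e x); case: (e' x); lia.
  - move=> hd; have eqi : index (sg x) r = index (sg' x) r.
      by move: hd; case: (e x); case: (e' x); lia.
    split; last by move: hd; rewrite eqi; case: (e x); case: (e' x); lia.
    rewrite -(nth_index x (partner_in_behead h sx)) eqi nth_index //.
    exact: partner_in_behead h' sx'.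
have g := coloured_involution_behead ur h.
have g' := coloured_involution_behead ur h'.
have /andP[xr ur'] := ur.
rewrite -sxx' in g' tl.
have [|eqs eqe] := IHk _ (rem_uniq (sg x) ur') _ g g' tl.
  by apply: leq_trans (rk : size r <= k); rewrite size_subseq // rem_subseq.
have [_ ssx esx] := h x (mem_head _ _).
have [_ ssx' esx'] := h' x (mem_head _ _).
split=> y; rewrite inE => /orP[/eqP-> //|yr];
  have [->|yx] := eqVneq y (sg x).
- by rewrite ssx sxx' ssx'.
- by apply: eqs; rewrite mem_rem_uniq // inE yx.
- by rewrite esx sxx' esx'.
- by apply: eqe; rewrite mem_rem_uniq // inE yx.
Qed.

(** Decoding extends the involution obtained for the remaining list by the orbit that the head code
    prescribes. *)
Lemma enc_surj (T : eqType) k (r : seq T) c :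
  uniq r -> size r <= k -> valid (size r) c ->
  exists sg e, coloured_involution r sg e /\ enc sg e k r = c.
Proof.
elim: k r c => [|k IHk] [|x r] [|l c] //=.
- by exists id, xpredT; split.
- by exists id, xpredT; split.
rewrite ltnS => /andP[xr ur] rk /andP[l_lt vc].
(* For a 2-cycle [l = (q + 1).*2 + b], so the partner of [x] stands at index [q = l./2 - 1]. *)
pose y := if l < 2 then x else nth x r l./2.-1.
have [] // := IHk (rem y r) c _ _ _.
- exact: rem_uniq.
- by apply: leq_trans rk; rewrite size_subseq // rem_subseq.
- rewrite /y; move: vc; rewrite /width; case: ltnP => l2.
    by rewrite rem_id // subn1.
  by rewrite size_rem ?subn2 // mem_nth //; lia.
move=> sg [e [h encE]].
have yE : (y == x) = (l < 2).
  rewrite /y; case: ltnP => l2; first exact: eqxx.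
  apply: contraNF xr => /eqP<-; apply: mem_nth; lia.
have yr : y \in x :: r.
  rewrite /y; case: ltnP => l2; rewrite ?mem_head // inE mem_nth ?orbT //; lia.
pose sg' z := if z == x then y else if z == y then x else sg z.
pose e' z := if (z == x) || (z == y) then odd l else e z.
have remP z : z \in rem y r -> [/\ z \in r, z != x & z != y].
  rewrite mem_rem_uniq // inE => /andP[zy zr]; split=> //.
  by apply: contraNneq xr => <-.
have sg'x : sg' x = y by rewrite /sg' eqxx.
exists sg', e'; split.
  move=> z; rewrite /sg' /e'; have [->|zx] := eqVneq z x => [_|].
    by rewrite !eqxx !orbT /=; split=> //; case: eqP => // ->.
  have [->|zy] := eqVneq z y => [_|].
    by rewrite !eqxx !orbT mem_head.
  rewrite inE (negPf zx) => /= zr.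
  have [|sz ssz esz] := h z; first by rewrite mem_rem_uniq // inE zy.
  have [szr /negPf szx /negPf szy] := remP _ sz.
  by rewrite szx szy inE szr orbT.
rewrite sg'x yE /e' eqxx /=; congr (_ :: _).
  case: ifP => l2; first by case: (l) l2 => [|[]].
  rewrite /y l2 index_uniq //; lia.
rewrite -encE; apply: eq_in_enc => z /remP[_ zx zy].
  by rewrite /sg' (negPf zx) (negPf zy).
by rewrite (negPf zx) (negPf zy).
Qed.

(** Each code has the parity of the colour of its orbit. The encoding meets an orbit at its first
    element in [r], the count at the element with the smaller value of [v]; colours being constant
    on orbits, both count it once. *)
Lemma odd_sumn_enc (T : eqType) (v : T -> nat) (sg : T -> T) e k (r : seq T) :
  injective v -> uniq r -> size r <= k -> coloured_involution r sg e ->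
  odd (sumn (enc sg e k r)) = odd (count (fun x => e x && (v x <= v (sg x))) r).
Proof.
move=> v_inj; elim: k r => [|k IHk] [|x r] // ur rk h /=.
have h' := coloured_involution_behead ur h.
have /andP[xr ur'] := ur; rewrite /= ltnS in rk.
have rk' : size (rem (sg x) r) <= k.
  by apply: leq_trans rk; rewrite size_subseq // rem_subseq.
rewrite oddD {}IHk // ?rem_uniq // oddD oddb.
case: eqP => [sxx|/eqP sxx].
  by rewrite sxx rem_id // leqnn andbT oddb.
have sr := partner_in_behead h sxx.
have [_ ssx esx] := h x (mem_head _ _).
rewrite (permP (perm_to_rem sr)) /= oddD !oddD !oddb odd_double /= ssx esx addbA.
congr (_ (+) _).
have vx : v x != v (sg x) by rewrite (inj_eq v_inj) eq_sym.
by case: (e x) => //=; case: ltngtP vx.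
Qed.

(** * Codes of paths *)

Definition code_of_step (w : step * nat) : nat :=
  match w.1 with North => 0 | East => 1 | Diag => w.2 end.

Definition step_of_code (l : nat) : step * nat :=
  match l with 0 => (North, 1) | 1 => (East, 1) | _ => (Diag, l) end.

(** With [m = n + 1 - (i + k_i)] the label [2n + 3 - 2(i + k_i) - l] of clause (3) becomes
    [m.*2.+1 - l], and the upper bound on [l] becomes [l < m.*2]. *)
Definition mirror_step (m l : nat) : step * nat :=
  match l with 0 => (East, 1) | 1 => (North, 1) | _ => (Diag, m.*2.+1 - l) end.

Fixpoint word (m : nat) (c : seq nat) : seq (step * nat) :=
  if c is l :: c' then
    step_of_code l :: rcons (word (m - width l) c') (mirror_step m l)
  else [::].

Lemma size_word (m : nat) (c : seq nat) : size (word m c) = (size c).*2.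
Proof. by elim: c m => //= l c IHc m; rewrite size_rcons IHc doubleS. Qed.

Lemma take_word (m : nat) (c : seq nat) :
  take (size c) (word m c) = map step_of_code c.
Proof.
elim: c m => //= l c IHc m; rewrite -cats1 takel_cat ?IHc //.
by rewrite size_word -addnn leq_addr.
Qed.

Lemma step_of_codeK : cancel step_of_code code_of_step.
Proof. by case=> [|[]]. Qed.

(** * Peeling off the outer steps of a path *)

Lemma wstep1 x V : wstep (x :: V) 1 = x.
Proof. by []. Qed.

Lemma wstep_last x V y : wstep (x :: rcons V y) (size V).+2 = y.
Proof. by rewrite /wstep /= nth_rcons ltnn eqxx. Qed.

Lemma wstep_mid x V y i :
  0 < i <= size V -> wstep (x :: rcons V y) i.+1 = wstep V i.
Proof.
case: i => [|i] //= i_lt; rewrite /wstep /= nth_rcons.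
by rewrite i_lt.
Qed.

Lemma wk_mid x V y i :
  0 < i <= size V -> wk (x :: rcons V y) i.+1 = (x.2 != 1) + wk V i.
Proof.
case/andP=> i0 i_le; rewrite /wk [in LHS]/= -{1}(prednK i0) /= /wlab wstep1.
congr (_ + _); rewrite -[2]/(1 + 1) iotaDl count_map; apply: eq_in_count => j.
rewrite mem_iota => /andP[j1 j2] /=; rewrite add1n wstep_mid //; lia.
Qed.

(* Clause (3) for the inner part V of a path, the removed outer steps of which
   contribute s to i + k_i. *)
Definition mirrored_diag (n s : nat) (V : seq (step * nat)) : bool :=
  all (fun i => (wdir V i == Diag) ==>
         [&& 2 <= wlab V i,
             wlab V i <= (2 * n + 1) - 2 * (s + (i + wk V i))
           & wstep V ((size V).+1 - i) ==
               (Diag, (2 * n + 3) - 2 * (s + (i + wk V i)) - wlab V i)])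
      (iota 1 (size V)./2).

Definition mirrored_dir (V : seq (step * nat)) : bool :=
  all (fun i => (wdir V i == North) == (wdir V ((size V).+1 - i) == East))
      (iota 1 (size V)).

(** Clause (4) is left out because it fails for the empty word, at which the peeling of outer steps
    ends. *)
Definition mirrored_path (n : nat) (W : seq (step * nat)) : bool :=
  [&& all labelled_step W, ~~ odd (size W), delannoy n (map fst W),
      mirrored_dir W & mirrored_diag n 0 W].

Lemma mirrored_diag_shift n s V :
  s <= n -> mirrored_diag n s V = mirrored_diag (n - s) 0 V.
Proof.
move=> sn; apply: eq_in_all => i; rewrite mem_iota => /andP[i1 _].
have e b z : 2 * n + b - 2 * (s + z) = 2 * (n - s) + b - 2 * (0 + z) by lia.
by rewrite !e.
Qed.

Lemma mirrored_dir_cons x V y :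
  mirrored_dir (x :: rcons V y) =
  [&& (x.1 == North) == (y.1 == East), (y.1 == North) == (x.1 == East)
    & mirrored_dir V].
Proof.
rewrite /mirrored_dir /= size_rcons.
have -> : iota 2 (size V).+1 = iota 2 (size V) ++ [:: (size V).+2].
  by have := iotaD 2 (size V) 1; rewrite addn1 add2n.
rewrite all_cat /= /wdir wstep1 subSS subn0 wstep_last subSnn wstep1 andbT.
congr (_ && _); rewrite andbC; congr (_ && _).
rewrite -[2]/(1 + 1) iotaDl all_map; apply: eq_in_all => i; rewrite mem_iota => hi.
rewrite /= add1n wstep_mid; last by lia.
rewrite !subSS (_ : (size V).+2 - i = ((size V).+1 - i).+1); last by lia.
rewrite wstep_mid //; lia.
Qed.

Lemma mirrored_diag_cons n x V y :
  mirrored_diag n 0 (x :: rcons V y) =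
  ((x.1 == Diag) ==>
     [&& 2 <= x.2, x.2 <= 2 * n - 1 & y == (Diag, 2 * n + 1 - x.2)])
  && mirrored_diag n (x.2 != 1).+1 V.
Proof.
rewrite /mirrored_diag /= size_rcons /=; congr (_ && _).
  rewrite /wdir /wlab wstep1 subSS subn0 wstep_last /wk /= addn0 add0n.
  have e1 : 2 * n + 1 - 2 * 1 = 2 * n - 1 by lia.
  have e3 : 2 * n + 3 - 2 * 1 = 2 * n + 1 by lia.
  rewrite e1 e3 //.
rewrite -[2]/(1 + 1) iotaDl all_map; apply: eq_in_all => i; rewrite mem_iota => hi.
have hi' : 0 < i <= size V by lia.
rewrite /= add1n /wdir /wlab wstep_mid // wk_mid // !add0n.
rewrite !subSS (_ : (size V).+2 - i = ((size V).+1 - i).+1); last by lia.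
rewrite wstep_mid; last by lia.
have e d z : i.+1 + (d + z) = d.+1 + (i + z) by lia.
by rewrite e.
Qed.

Lemma delannoy_cons n (x y : step * nat) V :
  delannoy n (map fst (x :: rcons V y)) =
  (step_dx x.1 + step_dx y.1 + sumn (map step_dx (map fst V)) == n) &&
  (step_dy x.1 + step_dy y.1 + sumn (map step_dy (map fst V)) == n).
Proof.
by rewrite /delannoy /= !map_rcons !sumn_rcons !addnA
  ![_ + _ + step_dx _]addnAC ![_ + _ + step_dy _]addnAC.
Qed.

(** Removing the two outer steps obeys the recursion of [valid]: a pair N, E or E, N advances both
    coordinates by 1 and a pair D, D by 2, which is the width of the code. *)
Lemma mirrored_path_cons n x V y :
  mirrored_path n (x :: rcons V y) =
  [&& x == step_of_code (code_of_step x), y == mirror_step n (code_of_step x),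
      code_of_step x < n.*2 & mirrored_path (n - width (code_of_step x)) V].
Proof.
rewrite /mirrored_path mirrored_dir_cons mirrored_diag_cons delannoy_cons.
rewrite mul2n addn1 /= all_rcons size_rcons /= negbK /labelled_step /delannoy.
set dx := sumn _; set dy := sumn _; set lV := all _ V.
have fixed_step a b :
    [&& [&& (0 < a) && (a == 1), (0 < b) && (b == 1) & lV], ~~ odd (size V),
        (dx.+1 == n) && (dy.+1 == n), mirrored_dir V & mirrored_diag n (a != 1).+1 V]
    = [&& a == 1, b == 1, 0 < n, lV, ~~ odd (size V),
          (dx == n - 1) && (dy == n - 1), mirrored_dir V & mirrored_diag (n - 1) 0 V].
  case: eqVneq => [->|]; last by rewrite andbF.
  case: eqVneq => [->|]; last by rewrite !andbF.
  case: n => [|n'] /=; first by rewrite !andbF.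
  by rewrite !eqSS mirrored_diag_shift // subn1.
case: x y => [[] a] [[] b] /=; rewrite ?andbF //.
- by rewrite !xpair_eqE fixed_step /= double_gt0.
- rewrite !xpair_eqE fixed_step /=; congr [&& _, _ & _ && _].
  by case: n {fixed_step}.
- by case: a => [|[|a]]; rewrite ?andbF.
- by case: a => [|[|a]]; rewrite ?andbF.
case: a => [|[|a]]; rewrite ?andbF //= eqxx /= subn2.
(* Two diagonal steps force [n >= 2]. *)
case: n {fixed_step} => [|[|n']]; rewrite ?andbF //=.
rewrite mirrored_diag_shift // !addSn !add0n !eqSS subn2.
have -> : (a.+1 < n'.+2.*2 - 1) = (a.+2 < n'.+2.*2) by lia.
rewrite [code_of_step _]/=; case a_lt: (a.+2 < _); rewrite ?andbF //= !xpair_eqE /=.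
case: (b =P n'.+2.*2.+1 - a.+2) => [->|_]; rewrite ?andbF //= andbT.
by rewrite subn_gt0 ltnS (ltnW a_lt).
Qed.

Lemma mirrored_word (n : nat) (c : seq nat) :
  mirrored_path n (word n c) = valid n c.
Proof.
elim: c n => [|l c IHc] n.
  by rewrite /mirrored_path /delannoy /= andbb andbT eq_sym.
by rewrite /= mirrored_path_cons step_of_codeK !eqxx IHc.
Qed.

Lemma mirrored_pathP (n : nat) (W : seq (step * nat)) :
  mirrored_path n W -> exists c, W = word n c.
Proof.
have [k] := ubnP (size W); elim: k n W => // k IHk n [|x W]; first by exists [::].
case/lastP: W => [|V y] //=; first by rewrite /mirrored_path andbF.
rewrite size_rcons mirrored_path_cons => Vk /and4P[/eqP x_ /eqP y_ _ hV].
have [|c ->] := IHk _ _ _ hV; first by lia.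
by exists (code_of_step x :: c); rewrite /= -x_ -y_.
Qed.

(** The last step of the first half comes from the last code, which is below 4. As E has code 1 and
    [(D, 3)] code 3, clause (4) asks for an odd last code. *)
Lemma weighted_word (n : nat) (c : seq nat) :
  0 < n -> weighted_delannoy n (word n c) = valid n c && odd (last 0 c).
Proof.
move=> n_gt0.
have -> : weighted_delannoy n (word n c) = mirrored_path n (word n c) &&
   ((wdir (word n c) (size (word n c))./2 == East)
      || (wstep (word n c) (size (word n c))./2 == (Diag, 3))).
  by rewrite /weighted_delannoy /mirrored_path -!andbA.
rewrite mirrored_word; case vc: (valid n c) => //=.
have [c' [l cE]] := valid_nonempty n_gt0 vc.
have l4 : l < 4 by apply: (@valid_last_lt4 n c'); rewrite -cE.
rewrite size_word doubleK /wdir.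
have -> : wstep (word n c) (size c) = step_of_code l.
  rewrite cE /wstep -(@nth_take (size (rcons c' l))) ?size_rcons //=.
  rewrite -[in X in nth _ X _](size_rcons c' l) take_word map_rcons nth_rcons.
  by rewrite size_map ltnn eqxx.
rewrite cE last_rcons; case: l l4 {cE} => [|[|[|[|]]]] //.
Qed.

(** * Clans as coloured involutions *)

(** The default [i] turns the positions of signs into fixed points. *)
Definition partner m (s : m.-tuple symbol) (i : 'I_m) : 'I_m :=
  odflt i [pick j | matched s i j].

Lemma count_mem_tuple (T : eqType) m (s : m.-tuple T) (c : T) :
  count_mem c s = #|[set j | tnth s j == c]|.
Proof.
rewrite -[in LHS](map_tnth_enum s) count_map enumT cardsE cardE.
by rewrite /enum_mem size_filter; apply: eq_count => i.
Qed.

(** A number occurring exactly twice has one other position, so matching is the graph of [partner]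
    off the diagonal. *)
Lemma matched_partner m (s : m.-tuple symbol) (i j : 'I_m) :
  all (fun c => is_number c ==> (count_mem c s == 2)) s ->
  matched s i j = (i != j) && (partner s i == j).
Proof.
move=> /allP s2; rewrite /partner.
have uniq_match k k' : matched s i k -> matched s i k' -> k = k'.
  move=> /and3P[ik num /eqP ek] /and3P[ik' _ /eqP ek'].
  have := s2 _ (mem_tnth i s); rewrite num count_mem_tuple /=.
  case/cards2P=> a [b [_ /setP ab]].
  have := (ab i, ab k, ab k'); rewrite !inE -ek -ek' eqxx.
  case=> [[]] /esym/orP[]/eqP ia /esym/orP[]/eqP ka /esym/orP[]/eqP ka';
    by rewrite ia ka ka' ?eqxx // in ik ik' *.
case: pickP => [k ik|no_match] /=.
  apply/idP/andP => [ij|[_ /eqP<-] //].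
  by rewrite (uniq_match _ _ ik ij) eqxx; case/and3P: ij.
by rewrite no_match andNb.
Qed.

Lemma matched_sym m (s : m.-tuple symbol) (i j : 'I_m) :
  matched s i j = matched s j i.
Proof.
rewrite /matched eq_sym; case: (tnth s i =P tnth s j) => [->|/eqP ne].
  by rewrite eqxx.
by rewrite [tnth s j == _]eq_sym (negPf ne) !andbF.
Qed.

Lemma partnerK m (s : m.-tuple symbol) :
  all (fun c => is_number c ==> (count_mem c s == 2)) s ->
  involutive (partner s).
Proof.
move=> s2 i; have [e|ne] := eqVneq (partner s i) i; first by rewrite !e.
have : matched s i (partner s i) by rewrite matched_partner // eq_sym ne eqxx.
by rewrite matched_sym matched_partner // => /andP[_ /eqP].
Qed.

Lemma is_number_partner m (s : m.-tuple symbol) i :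
  all (fun c => is_number c ==> (count_mem c s == 2)) s ->
  is_number (tnth s i) = (partner s i != i).
Proof.
move=> s2; apply/idP/idP => [num|ne]; last first.
  have : matched s i (partner s i) by rewrite matched_partner // eq_sym ne eqxx.
  by case/and3P.
have := allP s2 _ (mem_tnth i s); rewrite num count_mem_tuple /=.
case/cards2P=> a [b [ab /setP e]].
have [j ji sj] : exists2 j, j != i & tnth s j == tnth s i.
  have := (e i, e a, e b); rewrite !inE !eqxx orbT.
  move=> -[[/esym/orP[/eqP ia|/eqP ib] ea] eb].
    by exists b; rewrite // ia eq_sym.
  by exists a; rewrite // ib.
have : matched s i j by rewrite /matched eq_sym ji num eq_sym sj.
by rewrite matched_partner // => /andP[_ /eqP->].
Qed.

(** The smaller element of a 2-cycle serves as the number at its two positions, so distinct cycles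
    get distinct numbers. *)
Definition clan_of m (p : 'I_m -> 'I_m) (sg : 'I_m -> bool) : m.-tuple symbol :=
  mktuple (fun i => if p i == i then inl (sg i) else inr (minn i (p i))).

Lemma clan_of_inl m (p : 'I_m -> 'I_m) sg i b :
  (tnth (clan_of p sg) i == inl b) = (p i == i) && (sg i == b).
Proof. by rewrite tnth_mktuple; case: (p i == i). Qed.

Lemma matched_clan_of m (p : 'I_m -> 'I_m) sg i j :
  involutive p -> matched (clan_of p sg) i j = (i != j) && (p i == j).
Proof.
move=> pK; have [->|ij] := eqVneq i j; first by rewrite /matched eqxx.
rewrite /matched ij !tnth_mktuple /=.
have [pi|pi] /= := eqVneq (p i) i; first by rewrite pi (negPf ij).
have [pj|pj] /= := eqVneq (p j) j.
  by apply/esym; apply: contraNF ij => /eqP pij; rewrite -(pK i) pij pj.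
rewrite -[LHS]/(minn i (p i) == minn j (p j)); apply/eqP/eqP => [|<-]; last first.
  by rewrite pK minnC.
have ne (a b : 'I_m) : a != b -> (a : nat) <> b by move=> /eqP ab /val_inj.
have [->|/ne pij] := eqVneq (p i) j => //.
have pij' : (p i : nat) <> p j.
  by apply: ne; apply: contraNneq ij => e; rewrite -(pK i) e pK.
have pij'' : (i : nat) <> p j.
  by apply: ne; apply: contra_not_neq pij => ->; rewrite pK.
have := (ne _ _ ij, ne _ _ pi, ne _ _ pj) => -[[]]; lia.
Qed.

(** * Folding a clan onto its first half *)

Definition fold_half n (i : 'I_(2 * n)) : 'I_(2 * n) := if i < n then i else rev_ord i.

Definition first_half n : seq 'I_(2 * n) :=
  [seq i : 'I_(2 * n) <- enum 'I_(2 * n) | i < n].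

Definition half_inv n (s : (2 * n).-tuple symbol) (i : 'I_(2 * n)) : 'I_(2 * n) :=
  fold_half (partner s i).

(** For [i < n], true on the orbits that condition (iii) counts: minus signs, and pairs within one
    half. *)
Definition half_col n (s : (2 * n).-tuple symbol) (i : 'I_(2 * n)) : bool :=
  if partner s i == i then tnth s i == minus else partner s i < n.

Lemma mem_first_half n (i : 'I_(2 * n)) : (i \in first_half n) = (i < n).
Proof. by rewrite mem_filter mem_enum andbT. Qed.

Lemma first_half_uniq n : uniq (first_half n).
Proof. by rewrite filter_uniq ?enum_uniq. Qed.

Lemma size_first_half n : size (first_half n) = n.
Proof.
rewrite size_filter -(count_map val (fun i => i < n)) val_enum_ord mul2n -addnn.
rewrite iotaD count_cat add0n.
rewrite (eq_in_count (a2 := predT)); last first.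
  by move=> i; rewrite mem_iota add0n => /andP[].
rewrite (eq_in_count (s := iota n n) (a2 := pred0)).
  by rewrite count_pred0 count_predT size_iota addn0.
by move=> i; rewrite mem_iota => /andP[ni _] /=; rewrite ltnNge ni.
Qed.

Lemma rev_ord_lt n (i : 'I_(2 * n)) : (rev_ord i < n) = ~~ (i < n).
Proof. have := ltn_ord i; rewrite /=; lia. Qed.

Lemma rev_ord_neq n (i : 'I_(2 * n)) : rev_ord i != i.
Proof.
apply/eqP => /(congr1 (fun j : 'I__ => j < n)).
by rewrite rev_ord_lt; case: (i < n).
Qed.

(* Conditions (i) and (ii) on the matching p of a clan, where the positions of
   signs are fixed by p. *)
Definition mirror_matching n (p : 'I_(2 * n) -> 'I_(2 * n)) : Prop :=
  [/\ involutive p, forall i, p (rev_ord i) = rev_ord (p i)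
    & forall i, p i != rev_ord i].

Lemma fold_half_lt n (i : 'I_(2 * n)) : fold_half i < n.
Proof. by rewrite /fold_half; case: ifP => // /negbT; rewrite -rev_ord_lt. Qed.

(** If [p i] lies in the second half, [p] sends its mirror image to that of [i], which folds back to
    [i]; the halves differ again, so the colour is kept. *)
Lemma mirror_matching_half n (p : 'I_(2 * n) -> 'I_(2 * n)) (sg : 'I_(2 * n) -> bool) :
  mirror_matching p ->
  coloured_involution (first_half n) (fun i => fold_half (p i))
    (fun i => if p i == i then sg i else p i < n).
Proof.
case=> pK p_rev p_neq i; rewrite !mem_first_half => i_lt; rewrite fold_half_lt.
have [pi|pi] := eqVneq (p i) i.
  by rewrite pi /fold_half i_lt pi i_lt eqxx.
rewrite /fold_half; case pi_lt: (p i < n); rewrite ?pi_lt.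
  by rewrite pK i_lt eq_sym (negPf pi).
by rewrite p_rev pK rev_ord_lt i_lt /= rev_ordK (inj_eq rev_ord_inj) eq_sym (negPf pi).
Qed.

(** Inverse to folding: colour true keeps the partner in the first half, colour false reflects it,
    and the second half is filled by mirror symmetry. *)
Definition unfold_half n (sg : 'I_(2 * n) -> 'I_(2 * n)) (e : 'I_(2 * n) -> bool)
    (i : 'I_(2 * n)) : 'I_(2 * n) :=
  let f i := if sg i == i then i else if e i then sg i else rev_ord (sg i) in
  if i < n then f i else rev_ord (f (rev_ord i)).

Lemma unfold_half_lt n sg (e : 'I_(2 * n) -> bool) (i : 'I_(2 * n)) :
  i < n -> unfold_half sg e i =
           if sg i == i then i else if e i then sg i else rev_ord (sg i).
Proof. by rewrite /unfold_half => ->. Qed.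

Lemma unfold_half_rev n sg (e : 'I_(2 * n) -> bool) i :
  unfold_half sg e (rev_ord i) = rev_ord (unfold_half sg e i).
Proof.
rewrite /unfold_half rev_ord_lt rev_ordK.
by case: (i < n); rewrite /= ?rev_ordK.
Qed.

Lemma mirror_ind n (P : 'I_(2 * n) -> Prop) :
  (forall i : 'I_(2 * n), i < n -> P i) -> (forall i, P i -> P (rev_ord i)) ->
  forall i, P i.
Proof.
move=> P_lt P_rev i; have [/P_lt//|] := boolP (i < n).
by rewrite -rev_ord_lt => /P_lt/P_rev; rewrite rev_ordK.
Qed.

Lemma unfold_half_matching n sg (e : 'I_(2 * n) -> bool) :
  coloured_involution (first_half n) sg e -> mirror_matching (unfold_half sg e).
Proof.
move=> h; split; last 1 first.
- apply: mirror_ind => i; last by rewrite unfold_half_rev (inj_eq rev_ord_inj).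
  move=> i_lt; rewrite unfold_half_lt //.
  have := h i; rewrite mem_first_half => /(_ i_lt)[]; rewrite mem_first_half => s_lt _ _.
  case: (eqVneq (sg i) i) => [_|si]; first by rewrite eq_sym rev_ord_neq.
  case: ifP => _; last by rewrite (inj_eq rev_ord_inj).
  by apply: contraTneq s_lt => ->; rewrite rev_ord_lt i_lt.
- apply: mirror_ind => i; last by rewrite !unfold_half_rev => ->.
  move=> i_lt; have := h i; rewrite mem_first_half => /(_ i_lt)[].
  rewrite mem_first_half => s_lt ss es; rewrite (unfold_half_lt _ _ i_lt).
  case: (eqVneq (sg i) i) => [si|si]; first by rewrite unfold_half_lt // si eqxx.
  by case ei: (e i); rewrite ?unfold_half_rev unfold_half_lt // ss eq_sym;
    rewrite (negPf si) es ei // rev_ordK.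
- by move=> i; rewrite unfold_half_rev.
Qed.

Lemma fold_unfold_half n sg (e : 'I_(2 * n) -> bool) (i : 'I_(2 * n)) :
  coloured_involution (first_half n) sg e -> i < n ->
  fold_half (unfold_half sg e i) = sg i.
Proof.
move=> h i_lt; rewrite unfold_half_lt //.
have := h i; rewrite mem_first_half => /(_ i_lt)[]; rewrite mem_first_half => s_lt _ _.
case: eqP => [->|_]; first by rewrite /fold_half i_lt.
case: (e i); first by rewrite /fold_half s_lt.
by rewrite /fold_half rev_ord_lt s_lt rev_ordK.
Qed.

Lemma unfold_half_colour n sg (e : 'I_(2 * n) -> bool) (i : 'I_(2 * n)) :
  coloured_involution (first_half n) sg e -> i < n ->
  (if unfold_half sg e i == i then e i else unfold_half sg e i < n) = e i.
Proof.
move=> h i_lt; rewrite unfold_half_lt //.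
have := h i; rewrite mem_first_half => /(_ i_lt)[]; rewrite mem_first_half => s_lt _ _.
case: (eqVneq (sg i) i) => [_|si]; first by rewrite eqxx.
case: (e i); first by rewrite (negPf si) s_lt.
by rewrite rev_ord_lt s_lt; case: ifP.
Qed.

(** The folded partner gives [p i] up to reflection and the colour tells the half. Fixed points must
    be recognised first, since there the colour means a sign. *)
Lemma mirror_matching_eq n (p p' sg sg' : _) :
  @mirror_matching n p -> @mirror_matching n p' ->
  (forall i : 'I_(2 * n), i < n -> fold_half (p i) = fold_half (p' i)) ->
  (forall i : 'I_(2 * n), i < n ->
     (if p i == i then sg i else p i < n)
     = (if p' i == i then sg' i else p' i < n)) ->
  p =1 p' /\ (forall i : 'I_(2 * n), i < n -> p i == i -> sg i = sg' i).
Proof.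
move=> [pK p_rev p_neq] [pK' p_rev' p_neq'] eq_fold eq_col.
(* A position folded to itself is fixed: the alternative [q i = rev_ord i] is excluded by (ii). *)
have fold_id q (i : 'I_(2 * n)) : @mirror_matching n q -> i < n ->
    (fold_half (q i) == i) = (q i == i).
  case=> [qK q_rev q_neq] i_lt; rewrite /fold_half; case: ifP => // qi.
  rewrite (can2_eq (@rev_ordK _) (@rev_ordK _)) (negPf (q_neq i)).
  by apply/esym; apply: contraFF qi => /eqP->.
have fixE (i : 'I_(2 * n)) : i < n -> (p i == i) = (p' i == i).
  by move=> i_lt; rewrite -fold_id ?eq_fold ?fold_id.
have pp' : p =1 p'.
  apply: mirror_ind => i; last by rewrite p_rev p_rev' => ->.
  move=> i_lt; have := eq_col i i_lt; have := eq_fold i i_lt.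
  rewrite -fixE //; case: eqP => [pi|_]; last first.
    by rewrite /fold_half => + e; rewrite -e; case: ifP => // _ /rev_ord_inj.
  by move=> _ _; apply/esym/eqP; rewrite pi -fixE // pi.
by split=> // i i_lt /[dup] pi; have := eq_col i i_lt; rewrite -fixE // pi.
Qed.

Lemma clan_string_matching n (s : (2 * n).-tuple symbol) :
  clan_string n s -> same_clan s (rev_flip s) ->
  [forall i, is_number (tnth s i) ==> (tnth s i != tnth s (rev_ord i))] ->
  mirror_matching (partner s).
Proof.
case/and3P=> _ _ s2 /same_clanP[sgn mat] /forallP neq.
have num_neq i : partner s i != rev_ord i.
  apply/eqP => pi; have := neq i.
  have : matched s i (rev_ord i).
    by rewrite matched_partner // pi eqxx eq_sym rev_ord_neq.
  by case/and3P=> _ -> /eqP->; rewrite eqxx.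
split=> // [|i]; first exact: partnerK.
have mat_rev k j : matched s (rev_ord k) (rev_ord j) = matched s k j.
  by rewrite mat matched_rev_flip !rev_ordK.
have := mat_rev i (partner s i); rewrite !matched_partner // (inj_eq rev_ord_inj) eqxx.
case: (eqVneq i (partner s i)) => [e _|_ /eqP//].
(* If [i] carries a sign, its mirror position is not matched either: a match there would reflect to
   one of [i]. *)
have := mat_rev i (rev_ord (partner s (rev_ord i))).
rewrite rev_ordK !matched_partner // -e eqxx andbT.
case: (eqVneq (rev_ord i) (partner s (rev_ord i))) => [<- //|ne].
by rewrite andNb.
Qed.

(** The coloured orbits split into fixed points, which are the minus signs, and 2-cycles, which are
    the matched pairs in the first half. Requiring [i <= half_inv s i] picks one element per
    orbit. *)
Lemma parity_count n (s : (2 * n).-tuple symbol) :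
  all (fun c => is_number c ==> (count_mem c s == 2)) s ->
  mirror_matching (partner s) ->
  #|[set i : 'I_(2 * n) | (i < n) && (tnth s i == minus)]|
  + #|[set p : 'I_(2 * n) * 'I_(2 * n) |
        [&& p.1 < p.2, p.2 < n & matched s p.1 p.2]]|
  = count (fun i => half_col s i && (i <= half_inv s i)) (first_half n).
Proof.
move=> s2 [pK p_rev p_neq].
pose A := [set i : 'I_(2 * n) | [&& i < n, half_col s i & i <= half_inv s i]].
pose F := [set i | partner s i == i].
have -> : count (fun i => half_col s i && (i <= half_inv s i)) (first_half n) = #|A|.
  rewrite cardsE cardE /enum_mem size_filter /first_half count_filter enumT.
  by apply: eq_count => i /=; rewrite andbC.
rewrite -(cardsID F A); congr (_ + _).
  apply: eq_card => i; rewrite !inE /half_col /half_inv.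
  case: (boolP (i < n)) => //= i_lt; case: (eqVneq (partner s i) i) => [pi|pi].
    by rewrite /fold_half pi i_lt leqnn !andbT.
  by rewrite andbF; apply: contraNF pi => /eqP si;
    rewrite -[_ == i]negbK -is_number_partner // si.
rewrite -(card_imset (A :\: F) (f := fun i => (i, partner s i))); last by move=> i j [].
apply: eq_card => -[i j]; rewrite !inE /= matched_partner //.
apply/and3P/imsetP => [[ij jn /andP[_ /eqP pi]]|[k + [-> ->]]].
  exists i; last by rewrite pi.
  rewrite !inE /half_col /half_inv /fold_half pi jn (ltnW ij) (ltn_trans ij jn).
  by rewrite -!val_eqE (gtn_eqF ij).
rewrite !inE /half_col /half_inv => /andP[/[dup] pk /negPf->] /and3P[k_lt pk_lt].
rewrite /fold_half pk_lt leq_eqVlt => /orP[/eqP/val_inj e|->].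
  by rewrite -e eqxx in pk.
by rewrite eqxx eq_sym pk.
Qed.

Lemma clan_of_numbers m (p : 'I_m -> 'I_m) sg :
  involutive p ->
  all (fun c => is_number c ==> (count_mem c (clan_of p sg) == 2)) (clan_of p sg).
Proof.
move=> pK; apply/allP => c /tnthP[i ->]; apply/implyP => num.
rewrite count_mem_tuple.
have pi : i != p i.
  by apply: contraTneq num => e; rewrite tnth_mktuple -e eqxx.
rewrite (_ : [set j | _] = [set i; p i]) ?cards2 ?pi //.
apply/setP => j; rewrite !inE; have [->|ji] := eqVneq j i; first by rewrite eqxx.
have := matched_clan_of sg i j pK; rewrite /matched num eq_sym ji /=.
by rewrite [tnth _ j == _]eq_sym [j == _]eq_sym.
Qed.

Lemma clan_of_partner m (p : 'I_m -> 'I_m) sg :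
  involutive p -> partner (clan_of p sg) =1 p.
Proof.
move=> pK i; have := clan_of_numbers sg pK => s2.
have := matched_clan_of sg i (p i) pK; rewrite matched_partner // eqxx.
case: (eqVneq i (p i)) => [e _|_ /eqP //].
have := matched_clan_of sg i (partner (clan_of p sg) i) pK.
rewrite matched_partner // eqxx -e.
by case: eqP => //= <-.
Qed.

(** Opposite signs at mirrored positions give (i) on signs and, since reflection exchanges plus and
    minus, also equally many of both. *)
Lemma clan_of_DIII n (p : 'I_(2 * n) -> 'I_(2 * n)) sg :
  mirror_matching p -> (forall i, sg (rev_ord i) = ~~ sg i) ->
  [/\ clan_string n (clan_of p sg),
      same_clan (clan_of p sg) (rev_flip (clan_of p sg))
    & [forall i, is_number (tnth (clan_of p sg) i) ==>
         (tnth (clan_of p sg) i != tnth (clan_of p sg) (rev_ord i))]].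
Proof.
case=> pK p_rev p_neq sg_rev; set s := clan_of p sg.
have sgn i b : (tnth s (rev_ord i) == inl b) = (tnth s i == inl (~~ b)).
  rewrite !clan_of_inl p_rev (inj_eq rev_ord_inj) sg_rev.
  by congr (_ && _); case: (sg i) b => [] [].
split.
- rewrite /clan_string size_tuple eqxx clan_of_numbers // andbT andTb.
  rewrite !(count_mem_tuple s) -(card_preimset _ (@rev_ord_inj _)); apply/eqP.
  by apply: eq_card => i; rewrite !inE sgn.
- apply/same_clanP; split=> i.
    by move=> b; rewrite tnth_rev_flip flip_inl sgn negbK.
  move=> j; rewrite matched_rev_flip !matched_clan_of // p_rev.
  by rewrite !(inj_eq rev_ord_inj).
- apply/forallP => i; apply/implyP => num; apply: contra (p_neq i) => e.
  have : matched s i (rev_ord i) by rewrite /matched num e eq_sym rev_ord_neq.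
  by rewrite matched_clan_of // => /andP[].
Qed.

(** * Codes of clans *)

Definition clan_code n (s : (2 * n).-tuple symbol) : seq nat :=
  enc (half_inv s) (half_col s) n (first_half n).

Lemma DIII_matching n (s : (2 * n).-tuple symbol) :
  clan_string n s -> DIII_word s -> mirror_matching (partner s).
Proof. by move=> cs /and3P[sm neq _]; apply: clan_string_matching. Qed.

Lemma half_coloured_involution n (s : (2 * n).-tuple symbol) :
  mirror_matching (partner s) ->
  coloured_involution (first_half n) (half_inv s) (half_col s).
Proof. exact: mirror_matching_half. Qed.

Lemma clan_code_parity n (s : (2 * n).-tuple symbol) :
  clan_string n s -> mirror_matching (partner s) ->
  odd (sumn (clan_code s)) =
  odd (#|[set i : 'I_(2 * n) | (i < n) && (tnth s i == minus)]|
       + #|[set p : 'I_(2 * n) * 'I_(2 * n) |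
             [&& p.1 < p.2, p.2 < n & matched s p.1 p.2]]|).
Proof.
case/and3P=> _ _ s2 mm; rewrite parity_count // /clan_code.
rewrite (odd_sumn_enc (v := val)) ?first_half_uniq ?size_first_half //.
  exact: val_inj.
exact: half_coloured_involution.
Qed.

Lemma clan_code_valid n (s : (2 * n).-tuple symbol) :
  mirror_matching (partner s) -> valid n (clan_code s).
Proof.
move=> mm; rewrite -[X in valid X _](size_first_half n).
apply: enc_valid; rewrite ?first_half_uniq ?size_first_half //.
exact: half_coloured_involution.
Qed.

Lemma clan_code_inj n (s t : (2 * n).-tuple symbol) :
  clan_string n s -> DIII_word s -> clan_string n t -> DIII_word t ->
  clan_code s = clan_code t -> same_clan s t.
Proof.
move=> cs Ds ct Dt; have [ms mt] := (DIII_matching cs Ds, DIII_matching ct Dt).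
case/enc_inj; rewrite ?first_half_uniq ?size_first_half //;
  try exact: half_coloured_involution.
move=> eqs eqe.
have [|i i_lt|pp' sgE] :=
    @mirror_matching_eq n _ _ (fun i => tnth s i == minus)
      (fun i => tnth t i == minus) ms mt.
- by move=> i i_lt; apply: eqs; rewrite mem_first_half.
- by apply: eqe; rewrite mem_first_half.
case/and3P: cs ct => _ _ s2 /and3P[_ _ t2].
have [/and3P[/same_clanP[sgs _] _ _] /and3P[/same_clanP[sgt _] _ _]] := (Ds, Dt).
apply/same_clanP; split=> [|i j]; last by rewrite !matched_partner // pp'.
(* On the first half the colour of a fixed point separates minus from plus; condition (i) carries
   this to the second half. *)
apply: mirror_ind => i.
  move=> i_lt b; have [nums numt] := (is_number_partner i s2, is_number_partner i t2).
  have := sgE i i_lt; rewrite -pp' in numt.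
  move: nums numt; case: eqP => _ /=.
    by case: (tnth s i) => [x|//] _;
      case: (tnth t i) => [y|//] _ /(_ isT); case: x y b => [] [] [].
  by case: (tnth s i) => [//|x] _; case: (tnth t i) => [//|y] _.
by move=> IH b; rewrite sgs sgt !tnth_rev_flip !flip_inl rev_ordK IH.
Qed.

(** Makes the code independent of the representative that [repr] chooses. *)
Lemma same_clan_code n (s t : (2 * n).-tuple symbol) :
  same_clan s t -> clan_code s = clan_code t.
Proof.
case/same_clanP=> sgn mat.
have pE : partner s =1 partner t.
  by move=> i; rewrite /partner (eq_pick (mat i)).
apply: eq_in_enc => i _; first by rewrite /half_inv pE.
by rewrite /half_col pE sgn.
Qed.

Lemma clan_code_surj n (c : seq nat) :
  valid n c -> ~~ odd (sumn c) ->
  exists s : (2 * n).-tuple symbol,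
    [/\ clan_string n s, DIII_word s & clan_code s = c].
Proof.
move=> vc even_c.
have [|||sg [e [h encE]]] := @enc_surj _ n (first_half n) c.
- exact: first_half_uniq.
- by rewrite size_first_half.
- by rewrite size_first_half.
have mm := unfold_half_matching h.
(* On the first half colour true stands for minus, while [inl true] is plus, hence the negation;
   mirrored positions carry opposite signs. *)
pose b (i : 'I_(2 * n)) := if i < n then ~~ e i else e (rev_ord i).
have b_rev i : b (rev_ord i) = ~~ b i.
  by rewrite /b rev_ord_lt rev_ordK; case: (i < n); rewrite /= ?negbK.
have [cs sm neq] := clan_of_DIII mm b_rev.
set s := clan_of _ _ in cs sm neq.
have pE : partner s =1 unfold_half sg e by case: mm => pK _ _; apply: clan_of_partner.
have codeE : clan_code s = c.
  rewrite -encE; apply: eq_in_enc => i; rewrite mem_first_half => i_lt.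
    by rewrite /half_inv pE fold_unfold_half.
  rewrite -(unfold_half_colour h i_lt) /half_col pE /minus clan_of_inl /b i_lt.
by case: (_ == i); case: (e i).
exists s; split=> //; rewrite /DIII_word sm neq /=.
by rewrite -clan_code_parity ?codeE //; apply: clan_string_matching.
Qed.

(** * The forgotten last bit *)

(** The bit lost in [base] is recovered from the parity of the sum, which condition (iii) prescribes
    for clans. *)
Lemma base_parity_inj (m : nat) (c d : seq nat) :
  0 < m -> valid m c -> valid m d -> odd (sumn c) = odd (sumn d) ->
  base c = base d -> c = d.
Proof.
move=> m0 vc vd; have [c' [l ->]] := valid_nonempty m0 vc.
have [d' [k ->]] := valid_nonempty m0 vd.
rewrite !base_rcons !sumn_rcons !oddD => odd_eq [e lk].
have odd_lk : odd l = odd k by apply: (@addbI (odd (sumn d'))); rewrite -{1}e.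
by rewrite ?e -(odd_double_half l) odd_lk lk odd_double_half.
Qed.

(** On the path side clause (4) prescribes the lost bit directly. *)
Lemma base_last_inj (m : nat) (c d : seq nat) :
  0 < m -> valid m c -> valid m d -> odd (last 0 c) = odd (last 0 d) ->
  base c = base d -> c = d.
Proof.
move=> m0 vc vd; have [c' [l ->]] := valid_nonempty m0 vc.
have [d' [k ->]] := valid_nonempty m0 vd.
rewrite !base_rcons !last_rcons => odd_lk [-> lk].
by rewrite ?e -(odd_double_half l) odd_lk lk odd_double_half.
Qed.

Lemma valid_base (m : nat) (c : seq nat) :
  0 < m -> valid m c -> valid m (rcons (base c).1 (base c).2.*2).
Proof.
move=> m0 vc; have [c' [l cE]] := valid_nonempty m0 vc.
by move: vc; rewrite cE base_rcons; rewrite (@valid_rcons_half _ _ l l./2.*2) ?doubleK.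
Qed.

Lemma valid_rcons_bit (m : nat) (c : seq nat) q (b : bool) :
  valid m (rcons c (b + q.*2)) = valid m (rcons c q.*2).
Proof. by apply: valid_rcons_half; rewrite half_bit_double doubleK. Qed.

(** * Comparison of the two images *)

Definition path_base n (w : weighted_delannoy_path n) : seq nat * nat :=
  base [seq code_of_step x | x <- take (size (val w))./2 (val w)].

Lemma path_base_word n (w : weighted_delannoy_path n) c :
  val w = word n c -> path_base w = base c.
Proof.
by move=> wE; rewrite /path_base wE size_word doubleK take_word (mapK step_of_codeK).
Qed.

Lemma weighted_pathP n (w : weighted_delannoy_path n) :
  0 < n -> exists c, [/\ val w = word n c, valid n c & odd (last 0 c)].
Proof.
move=> n0; have wP := valP w.
have [c wE] : exists c, val w = word n c.
  apply: mirrored_pathP; case/and5P: wP => lW eW dW mW /andP[gW _].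
  by apply/and5P; split.
by exists c; move: wP; rewrite wE weighted_word // => /andP[].
Qed.

Theorem theorem5p15 (n : nat) (hn : 1 <= n) :
  exists f : weighted_delannoy_path n -> DIII_clan n, bijective f.
Proof.
pose clan_base (g : {g : clan n | clan_DIII g}) :=
  base (clan_code (val (repr (val g)))).
have clanP (g : {g : clan n | clan_DIII g}) :
    clan_string n (val (repr (val g))) /\ DIII_word (val (repr (val g))).
  by split; [exact: (valP (repr (val g))) | exact: (valP g)].
have even_code (s : (2 * n).-tuple symbol) :
    clan_string n s -> DIII_word s -> ~~ odd (sumn (clan_code s)).
  move=> cs Ds; rewrite clan_code_parity //; first by case/and3P: Ds.
  exact: DIII_matching.
apply: (@bijection_of_same_image {W | weighted_delannoy n W} {g : clan n | clan_DIII g}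
          _ (@path_base n) clan_base).
- move=> w w'; have [c [wE vc oc]] := weighted_pathP w hn.
  have [c' [wE' vc' oc']] := weighted_pathP w' hn.
  rewrite (path_base_word wE) (path_base_word wE') => e.
  apply: val_inj; rewrite wE wE'; congr word.
  by apply: (base_last_inj hn vc vc' _ e); rewrite oc oc'.
- move=> g g'; have [cg Dg] := clanP g; have [cg' Dg'] := clanP g' => e.
  apply: val_inj; rewrite -(reprK (val g)) -(reprK (val g')); apply/eqmodP.
  apply: clan_code_inj => //; apply: (base_parity_inj hn _ _ _ e).
  + by apply: clan_code_valid; apply: DIII_matching.
  + by apply: clan_code_valid; apply: DIII_matching.
  + by rewrite !(negPf (even_code _ _ _)).
(* Both images consist of the pairs [(c, q)] for which [rcons c q.*2] is valid. *)
- case=> c q; transitivity (valid n (rcons c q.*2)); split.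
  + case=> w; have [d [wE vd _]] := weighted_pathP w hn.
    by rewrite (path_base_word wE) => e; have := valid_base hn vd; rewrite e.
  (* The bit 1 makes the last code odd, as clause (4) demands. *)
  + rewrite -(valid_rcons_bit _ _ _ true) => vd.
    have wd : weighted_delannoy n (word n (rcons c (true + q.*2))).
      by rewrite weighted_word // vd last_rcons oddD odd_double.
    exists (exist (fun W => weighted_delannoy n W) _ wd).
    rewrite (@path_base_word _ _ (rcons c (true + q.*2))) // base_rcons.
    by rewrite half_bit_double.
  (* This bit makes the sum of the code even, as (iii) demands. *)
  + rewrite -(valid_rcons_bit _ _ _ (odd (sumn c))) => vd.
    have [|s [cs Ds sE]] := clan_code_surj vd.
      by rewrite sumn_rcons !oddD odd_double oddb addbF addbb.
    pose x : clan_word n := exist _ s cs.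
    have Dx : clan_DIII (\pi_(clan n) x)%qT by rewrite clan_DIII_pi.
    exists (exist (fun g => clan_DIII g) _ Dx); rewrite /clan_base.
    have sx : same_clan (val (repr (\pi_(clan n) x)%qT)) s.
      by have /eqmodP : (repr (\pi_(clan n) x) = x %[mod {eq_quot (@clan_equiv n)}])%qT
        by rewrite reprK.
    rewrite [val (exist _ _ _)]/= (same_clan_code sx).
    by rewrite sE base_rcons half_bit_double.
  + case=> g; have [cg Dg] := clanP g; rewrite /clan_base => e.
    have vg : valid n (clan_code (val (repr (val g)))).
      by apply: clan_code_valid; apply: DIII_matching.
    by have := valid_base hn vg; rewrite e.
Qed.
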